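(* Let $G$ be a finite skew-symmetric graph with symmetry $\sigma$ (writing $x'=\sigma(x)$), symmetric capacities $c\colon AG\to\mathbb{Z}_+$, and source $s$ (sink $s'$). For a maximum integer skew-symmetric $s$–$s'$ flow $f$, let $R_f$ be the set of nodes reachable from $s$ by $c_f$-regular paths in the residual graph $G_f$, and let $\mathcal{B}_f=(A,M;B_1,\dots,B_k)$ where $A=R_f-R_f'$, $M=VG-(R_f\cup R_f')$ and $B_1,\dots,B_k$ are the node sets of the weakly connected components of the subgraph of $G$ induced by $R_f\cap R_f'$. Then the sets $R_f$ are equal for all maximum integer skew-symmetric flows $f$; therefore the tuples $\mathcal{B}_f$ are equal as well.
   Context: A skew-symmetric graph is a digraph (parallel arcs allowed) with involutions $\sigma$ on nodes (with $\sigma(v)\ne v$) and on arcs such that for every arc $a$ from $u$ to $v$, $\sigma(a)$ is an arc from $\sigma(v)$ to $\sigma(u)$; for a set $X$ of nodes, $X'=\sigma(X)$. A function $\phi$ on arcs is symmetric if $\phi(a)=\phi(a')$. An integer skew-symmetric $s$–$s'$ flow is a symmetric $f\colon AG\to\mathbb{Z}_+$ with $\mathrm{div}_f(v)=f(\delta^{out}(v))-f(\delta^{in}(v))=0$ for all $v\ne s,s'$ and $\mathrm{div}_f(s)\ge0$; its value is $\mathrm{div}_f(s)$; it is feasible if $f\le c$; maximum means feasible of maximum value. Residual graph $G_f$: nodes $VG$; each arc $a$ with $f(a)<c(a)$ with $c_f(a)=c(a)-f(a)$, and for each arc $a=(u,v)$ with $f(a)>0$ a reverse arc $a^R=(v,u)$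 with $c_f(a^R)=f(a)$ (the mate of $a^R$ being $(a')^R$). A path (arc-simple walk) $P$ in $G_f$ is $c_f$-regular if $c_f(a)=c_f(a')\ge2$ for each pair of mates $a,a'$ both occurring in $P$. *)

(* Defs.v *)
From mathcomp Require Import all_boot all_order all_algebra.
From mathcomp Require Import boolp.

Set Implicit Arguments.
Unset Strict Implicit.
Unset Printing Implicit Defensive.

Import Order.TTheory GRing.Theory Num.Theory.

(* Parallel arcs are distinct elements of [garc] with the same ends.  Only the
   involution on nodes is required to be free of fixed points: an arc from v
   to sigma(v) may be its own mate. *)
Record skew_graph := SkewGraph {
  gnode : finType;
  garc : finType;
  gtail : garc -> gnode;
  ghead : garc -> gnode;
  nmate : gnode -> gnode;
  amate : garc -> garc;
  nmateK : involutive nmate;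
  nmate_neq : forall v, nmate v != v;
  amateK : involutive amate;
  tail_amate : forall a, gtail (amate a) = nmate (ghead a);
  head_amate : forall a, ghead (amate a) = nmate (gtail a)
}.

Section SkewFlows.
Variable G : skew_graph.

Definition mate_set (X : {set gnode G}) : {set gnode G} := @nmate G @: X.

Definition mate_symmetric (phi : garc G -> nat) : Prop :=
  forall a, phi (amate a) = phi a.

Definition divergence (f : garc G -> nat) (v : gnode G) : int :=
  ((\sum_(a | gtail a == v) f a)%N%:Z - (\sum_(a | ghead a == v) f a)%N%:Z)%R.

Definition skew_flow (s : gnode G) (f : garc G -> nat) : Prop :=
  [/\ mate_symmetric f,
      forall v, v != s -> v != nmate s -> divergence f v = 0%R
    & (0 <= divergence f s)%R].

Definition feasible_flow (c : garc G -> nat) (s : gnode G) (f : garc G -> nat) :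
    Prop :=
  skew_flow s f /\ forall a, f a <= c a.

Definition maximum_flow (c : garc G -> nat) (s : gnode G) (f : garc G -> nat) :
    Prop :=
  feasible_flow c s f /\
  forall g, feasible_flow c s g -> (divergence g s <= divergence f s)%R.

(* Potential residual arcs: [inl a] is a itself and [inr a] is its reverse
   a^R.  Those of positive residual capacity are the arcs of G_f. *)
Definition rarc : finType := (garc G + garc G)%type.

Definition rtail (e : rarc) : gnode G :=
  match e with inl a => gtail a | inr a => ghead a end.

Definition rhead (e : rarc) : gnode G :=
  match e with inl a => ghead a | inr a => gtail a end.

Definition rmate (e : rarc) : rarc :=
  match e with inl a => inl (amate a) | inr a => inr (amate a) end.

Definition rcap (c f : garc G -> nat) (e : rarc) : nat :=
  match e with inl a => c a - f a | inr a => f a end.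

Definition residual_arc (c f : garc G -> nat) : pred rarc :=
  fun e => 0 < rcap c f e.

Fixpoint walk (u : gnode G) (p : seq rarc) (v : gnode G) : bool :=
  if p is e :: q then (rtail e == u) && walk (rhead e) q v else u == v.

Definition residual_path (c f : garc G -> nat) (u : gnode G) (p : seq rarc)
    (v : gnode G) : bool :=
  [&& walk u p v, uniq p & all (residual_arc c f) p].

Definition regular (c f : garc G -> nat) (p : seq rarc) : Prop :=
  forall e, e \in p -> rmate e \in p ->
    rcap c f e = rcap c f (rmate e) /\ 2 <= rcap c f e.

Definition regular_reach (c f : garc G -> nat) (s : gnode G) : {set gnode G} :=
  [set v | `[< exists2 p, residual_path c f s p v & regular c f p >]].

Definition induced_adj (W : {set gnode G}) : rel (gnode G) :=
  fun u v => [&& u \in W, v \in W &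
    [exists a : garc G, ((gtail a == u) && (ghead a == v))
                    || ((gtail a == v) && (ghead a == u))]].

Definition weak_components (W : {set gnode G}) : {set {set gnode G}} :=
  equivalence_partition (connect (induced_adj W)) W.

(* The components B_1, ..., B_k carry no preferred order, so the tuple
   (A, M; B_1, ..., B_k) records them as a set of node sets. *)
Definition barrier (c f : garc G -> nat) (s : gnode G) :
    {set gnode G} * {set gnode G} * {set {set gnode G}} :=
  let R := regular_reach c f s in
  let R' := mate_set R in
  (R :\: R', ~: (R :|: R'), weak_components (R :&: R')).

End SkewFlows.

(* Main.v *)
(* If P is a c_f-regular path from s to v in G_f and P' is the reversed mate
   path, then h = f + P + P' - g is a symmetric flow in G_g, with divergence 1
   at s and v' and -1 at v and s'.  Follow arcs of positive h from s, each time
   subtracting one unit from the arc and one from its mate: away from v and s'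
   the divergence of what is left is positive at the current node, so the walk
   continues until it
   - meets v, which is then c_g-regularly reachable, or
   - meets s', and g can be augmented by 2, or
   - meets an arc of positive h that is its own mate, and g can be augmented
     by 1 along the walk, this arc, and the mate of the walk.
   The last two cases contradict the maximality of g. *)
Require Import Defs.
From mathcomp Require Import all_boot all_order all_algebra.
From mathcomp Require Import boolp zify ring.

Set Implicit Arguments.
Unset Strict Implicit.
Unset Printing Implicit Defensive.

Import Order.TTheory GRing.Theory Num.Theory.

Section ResidualWalks.
Variable G : skew_graph.
Implicit Types (e : rarc G) (p q : seq (rarc G)) (u v y : gnode G).
Implicit Types (c f : garc G -> nat) (k L : rarc G -> nat).

Lemma rmateK : involutive (@rmate G).
Proof. by case=> a /=; rewrite amateK. Qed.

Lemma rtail_mate e : rtail (rmate e) = nmate (rhead e).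
Proof. by case: e => a /=; rewrite ?tail_amate ?head_amate. Qed.

Lemma rhead_mate e : rhead (rmate e) = nmate (rtail e).
Proof. by case: e => a /=; rewrite ?tail_amate ?head_amate. Qed.

Lemma rcap_mate c f e :
  mate_symmetric c -> mate_symmetric f -> rcap c f (rmate e) = rcap c f e.
Proof. by move=> cS fS; case: e => a /=; rewrite ?cS fS. Qed.

Lemma walk_cat u p q v :
  walk u (p ++ q) v -> exists2 w, walk u p w & walk w q v.
Proof.
elim: p u => [|e p IHp] u /= => [|/andP[-> /IHp]]; last by [].
by exists u.
Qed.

Lemma walk_shorten u p v : walk u p v ->
  exists q, [/\ walk u q v, uniq q & {subset q <= p}].
Proof.
elim: p u => [|e p IHp] u /=; first by exists [::].
case/andP=> /eqP tail_e /IHp[q [walk_q uniq_q sub_qp]].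
have [e_q | e'q] := boolP (e \in q); last first.
  exists (e :: q); rewrite /= tail_e eqxx e'q; split=> // x.
  by rewrite !inE => /predU1P[-> | /sub_qp ->]; rewrite ?eqxx ?orbT.
(* [e] recurs in the shortened tail: the closed walk before this occurrence is cut out. *)
case/splitPr: e_q walk_q uniq_q sub_qp => q1 q2 /walk_cat[w _ /= /andP[_ walk_q2]].
rewrite cat_uniq => /and3P[_ _ uniq_q2] sub_qp.
exists (e :: q2); split=> //=; first by rewrite tail_e eqxx.
move=> x; rewrite !inE => /predU1P[-> | x_q2]; first by rewrite eqxx.
by rewrite sub_qp ?orbT // mem_cat inE x_q2 !orbT.
Qed.

Definition incidence e v : int := ((rtail e == v)%N%:Z - (rhead e == v)%N%:Z)%R.

Definition rdiv L v : int := (\sum_e (L e)%:Z * incidence e v)%R.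

Lemma divergenceE f v :
  divergence f v = (\sum_a (f a)%:Z * incidence (inl a) v)%R.
Proof.
have sum_ind (P : pred (garc G)) :
    ((\sum_(a | P a) f a)%N%:Z = \sum_a (f a)%:Z * (P a)%N%:Z)%R.
  rewrite -natz natr_sum big_mkcond; apply: eq_bigr => a _.
  by case: (P a); rewrite ?mulr1 ?mulr0 ?natz.
rewrite /divergence !sum_ind -sumrB; apply: eq_bigr => a _.
by rewrite /incidence mulrBr.
Qed.

Lemma rdivE L v :
  rdiv L v = (\sum_a ((L (inl a))%:Z - (L (inr a))%:Z) * incidence (inl a) v)%R.
Proof.
rewrite /rdiv big_sumType /= -big_split /=; apply: eq_bigr => a _ /=.
by rewrite /incidence /=; ring.
Qed.

Lemma rdivD L1 L2 v :
  rdiv (fun e => L1 e + L2 e) v = (rdiv L1 v + rdiv L2 v)%R.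
Proof. by rewrite /rdiv -big_split; apply: eq_bigr => e _; rewrite PoszD mulrDl. Qed.

Lemma eq_rdiv L1 L2 v : L1 =1 L2 -> rdiv L1 v = rdiv L2 v.
Proof. by move=> eqL; apply: eq_bigr => e _; rewrite eqL. Qed.

Lemma rdiv_pred1 e v : rdiv (fun x => x == e) v = incidence e v.
Proof.
rewrite /rdiv (bigD1 e) //= eqxx mul1r big1 ?addr0 // => x /negPf->.
exact: mul0r.
Qed.

Lemma rdiv_gt0 L v : (0 < rdiv L v)%R -> exists2 e, rtail e = v & 0 < L e.
Proof.
move=> divL_gt0; apply: contrapT => noL; move: divL_gt0; apply/negP.
rewrite -leNgt; apply: sumr_le0 => e _; rewrite /incidence.
have [tail_e | _] := eqVneq (rtail e) v.
  suff ->: L e = 0 by rewrite mul0r.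
  by case: (posnP (L e)) => // Le_gt0; case: noL; exists e.
by rewrite sub0r mulrN oppr_le0.
Qed.

(* The multiplicity of [e] in the union of the walk [p] and its mate. *)
Definition load p e : nat := count_mem e p + count_mem (rmate e) p.

Lemma load_mate p e : load p (rmate e) = load p e.
Proof. by rewrite /load rmateK addnC. Qed.

Lemma load_cons e p x :
  load (e :: p) x = (x == e) + (x == rmate e) + load p x.
Proof.
by rewrite /load /= (eq_sym e x) (eq_sym e (rmate x)) (inv_eq rmateK); lia.
Qed.

(** Incidences telescope along the walk, and along its mate, which runs from [nmate v] to
    [nmate u]. *)
Lemma rdiv_load u p v y : walk u p v ->
  rdiv (load p) y =
  ((u == y)%N%:Z - (v == y)%N%:Z + (nmate v == y)%N%:Z - (nmate u == y)%N%:Z)%R.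
Proof.
elim: p u => [|e p IHp] u /=.
  move/eqP->; rewrite /rdiv big1 => [|e _]; first by ring.
  by rewrite mul0r.
case/andP=> /eqP <- /IHp walk_p.
rewrite (eq_rdiv _ (load_cons e p)) 2!rdivD !rdiv_pred1 walk_p /incidence.
by rewrite rtail_mate rhead_mate; ring.
Qed.

(** No arc repeats in [p], so the load is 2 only where an arc and its mate both lie on [p], and
    there regularity gives capacity at least 2. *)
Lemma load_regular c f u p v e : mate_symmetric c -> mate_symmetric f ->
  residual_path c f u p v -> regular c f p -> load p e <= rcap c f e.
Proof.
move=> cS fS /and3P[_ uniq_p /allP res_p] reg_p.
rewrite /load !count_uniq_mem //.
have [e_p | _] := boolP (e \in p); have [e'_p | _] := boolP (rmate e \in p) => //.
- by have [] := reg_p _ e_p e'_p.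
- exact: res_p.
- by rewrite -(rcap_mate _ cS fS); apply: res_p.
Qed.

(** Shortening keeps only arcs of [p]; if an arc and its mate both survive, its load, hence its
    capacity, is at least 2. *)
Lemma regular_of_load c f u p v : mate_symmetric c -> mate_symmetric f ->
    walk u p v -> (forall e, load p e <= rcap c f e) ->
  exists2 q, residual_path c f u q v & regular c f q.
Proof.
move=> cS fS /walk_shorten[q [walk_q uniq_q sub_qp]] load_p.
have count_gt0 e : e \in q -> 0 < count_mem e p.
  by move/sub_qp; rewrite -has_pred1 has_count.
exists q.
  rewrite /residual_path walk_q uniq_q; apply/allP => e /count_gt0 e_p.
  by apply: leq_trans (load_p e); rewrite addn_gt0 e_p.
move=> e /count_gt0 e_p /count_gt0 e'_p; split; first by rewrite rcap_mate.
by apply: leq_trans (load_p e); rewrite (leq_add e_p e'_p).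
Qed.

(** Induction on the total of [k]: off [T], the divergence bound yields an arc of positive [k]
    leaving [u], and it is an invariant of the walk. *)
Lemma follow_load k (T : pred (gnode G)) u :
    (forall e, k (rmate e) = k e) ->
    (forall y, ~~ T y -> ((u == y)%N%:Z - (nmate u == y)%N%:Z <= rdiv k y)%R) ->
  exists p y, [/\ walk u p y, forall e, load p e <= k e
    & T y \/ exists e, [/\ rmate e = e, rtail e = y
                       & forall x, load p x + (x == e) <= k x]].
Proof.
have [n] := ubnP (\sum_e k e); elim: n k u => // n IHn k u lt_kn kS div_k.
have [Tu | T'u] := boolP (T u).
  by exists [::], u; split=> //=; left.
have [|e tail_e ke_gt0] := @rdiv_gt0 k u.
  by apply: lt_le_trans (div_k u T'u); rewrite eqxx (negPf (nmate_neq u)).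
have [e_self | e'e] := eqVneq (rmate e) e.
  (* Only one unit of [k e] is sure to be there, so a self-mate arc, which a load counts twice, is
     kept out of the walk. *)
  exists [::], u; split=> //=; right; exists e; split=> // x.
  by rewrite /load /=; case: eqP => // ->.
pose k2 x := k x - (x == e) - (x == rmate e).
have kE x : k x = (x == e) + (x == rmate e) + k2 x.
  rewrite /k2; have [->|] := eqVneq x e; first by rewrite eq_sym (negPf e'e); lia.
  by have [->|] := eqVneq x (rmate e); rewrite ?kS; lia.
have [|x|y T'y|p [y [walk_p load_p stop_p]]] := IHn k2 (rhead e).
- rewrite -ltnS; apply: leq_ltn_trans lt_kn.
  rewrite (eq_bigr _ (fun x _ => kE x)) !big_split /=.
  by rewrite -[X in X < _]add0n ltn_add2r addn_gt0 (bigD1 e) //= eqxx.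
- by rewrite /k2 /= kS (inj_eq (inv_inj rmateK)) (inv_eq rmateK); lia.
(* Removing [e] and its mate moves the unit of the bound from [u] to [rhead e], and the opposite
   unit from [nmate u] to [nmate (rhead e)]. *)
- have := div_k y T'y; rewrite (eq_rdiv _ kE) 2!rdivD !rdiv_pred1 /incidence.
  by rewrite rtail_mate rhead_mate tail_e; lia.
exists (e :: p), y; split=> [|x|]; first by rewrite /= tail_e eqxx.
  by rewrite load_cons kE leq_add2l.
case: stop_p => [|[x [x_self tail_x load_x]]]; first by left.
right; exists x; split=> // z; rewrite load_cons kE.
by have := load_x z; lia.
Qed.

(** The subtraction is exact as soon as [L] respects the residual capacities, since then
    [L (inr a) <= f a]. *)
Definition push f L (a : garc G) : nat := f a + L (inl a) - L (inr a).

Lemma push_sym f L : mate_symmetric f -> (forall e, L (rmate e) = L e) ->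
  mate_symmetric (push f L).
Proof.
by move=> fS LS a; rewrite /push fS -(LS (inl a)) -(LS (inr a)).
Qed.

Lemma push_le c f L a : (forall x, f x <= c x) ->
  (forall e, L e <= rcap c f e) -> push f L a <= c a.
Proof.
by move=> /(_ a) fc Lf; have := Lf (inl a); rewrite /push /=; lia.
Qed.

Lemma divergence_push c f L v : (forall e, L e <= rcap c f e) ->
  divergence (push f L) v = (divergence f v + rdiv L v)%R.
Proof.
move=> Lf; rewrite !divergenceE rdivE -big_split; apply: eq_bigr => a _ /=.
rewrite -mulrDl; congr (_ * _)%R.
by have := Lf (inr a); rewrite /push /=; lia.
Qed.

(** Truncated subtraction puts the positive part of [f1 - f] on the arcs and its negative part on
    their reverses. *)
Definition flow_diff f1 f (e : rarc G) : nat :=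
  match e with inl a => f1 a - f a | inr a => f a - f1 a end.

Lemma flow_diff_mate f1 f e : mate_symmetric f1 -> mate_symmetric f ->
  flow_diff f1 f (rmate e) = flow_diff f1 f e.
Proof. by move=> f1S fS; case: e => a /=; rewrite f1S fS. Qed.

Lemma flow_diff_le c f1 f e :
  (forall a, f1 a <= c a) -> flow_diff f1 f e <= rcap c f e.
Proof. by move=> f1c; case: e => a /=; rewrite ?leq_sub2r ?leq_subr. Qed.

Lemma rdiv_flow_diff f1 f v :
  rdiv (flow_diff f1 f) v = (divergence f1 v - divergence f v)%R.
Proof.
rewrite !divergenceE rdivE -sumrB; apply: eq_bigr => a _ /=.
by rewrite -mulrBl; congr (_ * _)%R; lia.
Qed.

(** Pushing such an [L] would keep [f] feasible and raise its value by [d]. *)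
Lemma maximum_no_augment c f L s (d : int) :
    maximum_flow c s f -> (forall e, L (rmate e) = L e) ->
    (forall e, L e <= rcap c f e) -> (0 < d)%R ->
  ~ forall v, rdiv L v = (d * ((s == v)%N%:Z - (nmate s == v)%N%:Z))%R.
Proof.
move=> [[[fS f_cons f_ge0] fc] f_max] LS Lf d_gt0 divL.
have div_s : rdiv L s = d by rewrite divL eqxx (negPf (nmate_neq s)) subr0 mulr1.
suff /f_max : feasible_flow c s (push f L).
  by rewrite (divergence_push _ Lf) div_s; lia.
split=> [|a]; last exact: push_le.
split=> [|v v's v's'|]; first exact: push_sym.
- rewrite (divergence_push _ Lf) f_cons // divL 2!(eq_sym _ v).
  by rewrite (negPf v's) (negPf v's') subrr mulr0.
- by rewrite (divergence_push _ Lf) div_s addr_ge0 // ltW.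
Qed.

Lemma regular_reach_sub c f g s : mate_symmetric c ->
    maximum_flow c s f -> maximum_flow c s g ->
  regular_reach c f s \subset regular_reach c g s.
Proof.
move=> cS f_max g_max; apply/subsetP => v; rewrite !inE => /asboolP[p res_p reg_p].
have [[[fS f_cons _] fc] f_ge] := f_max.
have [[[gS g_cons _] gc] g_ge] := g_max.
have load_p e : load p e <= rcap c f e by apply: load_regular res_p reg_p.
have walk_p : walk s p v by case/and3P: res_p.
pose f1 := push f (load p).
have f1S : mate_symmetric f1 by apply: push_sym => // e; apply: load_mate.
have f1c a : f1 a <= c a by apply: push_le.
pose h := flow_diff f1 g.
have hS e : h (rmate e) = h e by apply: flow_diff_mate.
have h_le e : h e <= rcap c g e by apply: flow_diff_le.
pose stop := pred2 v (nmate s).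
have [y|q [y [walk_q load_q stop_q]]] := @follow_load h stop s hS.
  rewrite negb_or => /andP[y'v y's'].
  have fg_y : divergence f y = divergence g y.
    have [-> | y's] := eqVneq y s; last by rewrite f_cons ?g_cons.
    (* Conservation says nothing at [s]; there both divergences are the maximum value. *)
    apply: le_anti; apply/andP; split.
      by apply: g_ge; case: f_max.
    by apply: f_ge; case: g_max.
  rewrite rdiv_flow_diff (divergence_push _ load_p) fg_y (rdiv_load _ walk_p).
  (* The extra unit at [nmate v] is positive, so it only helps the lower bound. *)
  by rewrite (eq_sym v y) (negPf y'v); lia.
have load_g e : load q e <= rcap c g e by apply: leq_trans (load_q e) _.
case: stop_q => [/orP[] /eqP y_def | [e [e_self tail_e load_qe]]].
- by apply/asboolP; apply: regular_of_load load_g => //; rewrite -y_def.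
(* Both [q] and its mate run from [s] to [nmate s], whence the 2. *)
- case: (@maximum_no_augment c g (load q) s 2 g_max) => //.
    exact: load_mate.
  by move=> x; rewrite (rdiv_load _ walk_q) y_def nmateK; ring.
case: (@maximum_no_augment c g (fun x => load q x + (x == e)) s 1 g_max) => //.
- by move=> x; rewrite load_mate -{1}e_self (inj_eq (inv_inj rmateK)).
- by move=> x; apply: leq_trans (load_qe x) _.
move=> x; rewrite rdivD (rdiv_load _ walk_q) rdiv_pred1 /incidence.
(* Being its own mate, [e] runs from [y] to [nmate y], where the mate of [q] starts. *)
by rewrite -{2}e_self rhead_mate tail_e; ring.
Qed.

End ResidualWalks.

Theorem theorem7p4 (G : skew_graph) (c : garc G -> nat) (s : gnode G)
    (c_sym : mate_symmetric c) (f g : garc G -> nat)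
    (f_max : maximum_flow c s f) (g_max : maximum_flow c s g) :
  regular_reach c f s = regular_reach c g s /\ barrier c f s = barrier c g s.
Proof.
have reach_fg : regular_reach c f s = regular_reach c g s.
  by apply/eqP; rewrite eqEsubset !regular_reach_sub.
by rewrite /barrier reach_fg.
Qed.
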